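(* Let $t\ge2$, $N=t+2$, and let $\mathcal{T}_t$ be the set of partitions $\lambda$ with at most $N$ parts of two-class profile. Sending $\lambda$ to its two distinguished residues together with its $t$-quotient is a bijection $$\mathcal{T}_t\xrightarrow{\ \sim\ }\coprod_{0\le r_A<r_B\le t-1}\mathcal{P}_2\times\mathcal{P}_2\times\mathbb{Z}_{\ge0}^{\,t-2},\qquad \lambda\longmapsto\bigl(r_A,r_B;\ \lambda^{(r_A)},\lambda^{(r_B)};\ (m_i)_{i\ne r_A,r_B}\bigr),$$ where $m_i$ is the single part (possibly $0$) of $\lambda^{(i)}$. Under it the $t$-core $\operatorname{core}_t(\lambda)$ depends only on the pair $(r_A,r_B)$, and $$|\lambda|=\bigl|\operatorname{core}_t(\lambda)\bigr|+t\Bigl(\bigl|\lambda^{(r_A)}\bigr|+\bigl|\lambda^{(r_B)}\bigr|+\sum_{i\ne r_A,r_B}m_i\Bigr).$$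
   Context: $\mathcal{P}_2$ is the set of partitions with at most two parts. For $\lambda=(\lambda_1\ge\dots\ge\lambda_N\ge0)$ let $\beta_j=\lambda_j+N-j$ and $\beta(\lambda)=\{\beta_1>\dots>\beta_N\}$. $\lambda$ has two-class profile if exactly two residue classes modulo $t$, called the distinguished residues $r_A<r_B$ in $\{0,\dots,t-1\}$, contain two elements of $\beta(\lambda)$, and every other class contains exactly one. The $t$-quotient $(\lambda^{(0)},\dots,\lambda^{(t-1)})$ is computed from this beta set with $N$ elements: if the elements of $\beta(\lambda)$ congruent to $i$ modulo $t$ are $t\tilde a_1+i>\dots>t\tilde a_{n}+i$, then $\lambda^{(i)}=(\tilde a_1-n+1,\tilde a_2-n+2,\dots,\tilde a_n)$. $\operatorname{core}_t(\lambda)$ is the usual $t$-core, i.e. the partition whose $N$-element beta set has the same number $n_i$ of elements in each residue class $i$, namely $i,i+t,\dots,i+(n_i-1)t$. *)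

(* Defs.v *)
From mathcomp Require Import all_boot.

Set Implicit Arguments.
Unset Strict Implicit.
Unset Printing Implicit Defensive.

(* Partitions are weakly decreasing lists of positive parts, so trailing zeros
   are never stored and [size] is the number of (nonzero) parts. *)
Definition is_partition (s : seq nat) : bool := sorted geq s && (0 \notin s).

Definition intpart := {s : seq nat | is_partition s}.

Definition parts (lam : intpart) : seq nat := val lam.

Definition nparts (lam : intpart) : nat := size (parts lam).

Definition weight (lam : intpart) : nat := sumn (parts lam).

(* lambda_j for 0-based j, equal to 0 beyond the last part. *)
Definition part (lam : intpart) (j : nat) : nat := nth 0 (parts lam) j.

(* beta_j = lambda_j + N - j, with j shifted to start from 0; the list is
   strictly decreasing. It is only meant for [nparts lam <= N]. *)
Definition beta (N : nat) (lam : intpart) : seq nat :=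
  [seq part lam j + (N - j.+1) | j <- iota 0 N].

(* The partition (b_1 - n + 1, b_2 - n + 2, ..., b_n) attached to a finite set
   of naturals b_1 > ... > b_n, given by any list of its elements. The
   truncated subtractions are exact because the b_j strictly decrease. *)
Definition unbeta_seq (s : seq nat) : seq nat :=
  let b := sort geq (undup s) in
  let n := size b in
  [seq x <- [seq nth 0 b j - (n - j.+1) | j <- iota 0 n] | 0 < x].

Lemma unbeta_seqP (s : seq nat) : is_partition (unbeta_seq s).
Proof.
rewrite /is_partition /unbeta_seq mem_filter ltnn /= andbT.
set b := sort geq (undup s).
have geq_tr : transitive geq by move=> y x z xy yz; exact: leq_trans yz xy.
apply: sorted_filter => //.
have b_dec j : j.+1 < size b -> nth 0 b j.+1 < nth 0 b j.
  move=> lt_j; rewrite ltn_neqAle; apply/andP; split.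
    have ub : uniq b by rewrite sort_uniq undup_uniq.
    by rewrite nth_uniq ?(ltnW lt_j) // -[_ == _]negbK neq_ltn ltnSn orbT.
  have /(sortedP 0) : sorted geq b.
    by apply: sort_sorted => x y; exact: leq_total.
  exact.
apply/(sortedP 0) => j; rewrite size_map size_iota => lt_j.
rewrite !(nth_map 0) ?size_iota ?(ltnW lt_j) // !nth_iota ?(ltnW lt_j) //.
rewrite !add0n /geq /=.
have -> : size b - j.+1 = (size b - j.+2).+1 by rewrite -subSS subSn.
have lt_b := b_dec j lt_j.
by rewrite -(ltn_predK lt_b) subSS leq_sub2r // -ltnS (ltn_predK lt_b).
Qed.

Definition unbeta (s : seq nat) : intpart :=
  exist _ (unbeta_seq s) (unbeta_seqP s).

Lemma nparts_unbeta (s : seq nat) : nparts (unbeta s) <= size s.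
Proof.
rewrite /nparts /= size_filter (leq_trans (count_size _ _)) //.
by rewrite size_map size_iota size_sort size_undup.
Qed.

Definition residue_class (t N : nat) (lam : intpart) (i : nat) : seq nat :=
  [seq b <- beta N lam | b %% t == i].

Definition quotient (t N : nat) (lam : intpart) (i : nat) : intpart :=
  unbeta [seq b %/ t | b <- residue_class t N lam i].

(* The partition with beta set {i + k t : 0 <= i < t, 0 <= k < n_i}. *)
Definition core (t N : nat) (lam : intpart) : intpart :=
  unbeta [seq i + k * t | i <- iota 0 t,
                          k <- iota 0 (size (residue_class t N lam i))].

(* Pairs of residues r_A < r_B. *)
Definition respair (t : nat) := {r : 'I_t * 'I_t | r.1 < r.2}.

Definition resA (t : nat) (r : respair t) : 'I_t := (sval r).1.
Definition resB (t : nat) (r : respair t) : 'I_t := (sval r).2.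

Definition two_class_at (t N : nat) (lam : intpart) (r : respair t) : bool :=
  [forall i : 'I_t, size (residue_class t N lam i) ==
                    if (i == resA r) || (i == resB r) then 2 else 1].

Definition two_class (t N : nat) (lam : intpart) : bool :=
  [exists r : respair t, two_class_at N lam r].

(* The set T_t, with N = t + 2. *)
Definition two_class_partition (t : nat) :=
  {lam : intpart | (nparts lam <= t + 2) && two_class t (t + 2) lam}.

Lemma two_class_exists (t : nat) (lam : two_class_partition t) :
  exists r : respair t, two_class_at (t + 2) (sval lam) r.
Proof. by apply/existsP; case/andP: (valP lam). Qed.

(* The choice is unique: the distinguished residues are determined by lam. *)
Definition distinguished (t : nat) (lam : two_class_partition t) : respair t :=
  xchoose (two_class_exists lam).

Lemma distinguishedP (t : nat) (lam : two_class_partition t) :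
  two_class_at (t + 2) (sval lam) (distinguished lam).
Proof. exact: xchooseP. Qed.

(* Partitions with at most two parts. *)
Definition P2 := {lam : intpart | nparts lam <= 2}.

Lemma nparts_quotientA (t : nat) (lam : two_class_partition t) :
  nparts (quotient t (t + 2) (sval lam) (resA (distinguished lam))) <= 2.
Proof.
rewrite (leq_trans (nparts_unbeta _)) // size_map.
have /forallP/(_ (resA (distinguished lam)))/eqP -> := distinguishedP lam.
by rewrite eqxx.
Qed.

Lemma nparts_quotientB (t : nat) (lam : two_class_partition t) :
  nparts (quotient t (t + 2) (sval lam) (resB (distinguished lam))) <= 2.
Proof.
rewrite (leq_trans (nparts_unbeta _)) // size_map.
have /forallP/(_ (resB (distinguished lam)))/eqP -> := distinguishedP lam.
by rewrite eqxx orbT.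
Qed.

Definition other_residue (t : nat) (r : respair t) :=
  {i : 'I_t | (i != resA r) && (i != resB r)}.

Definition quotient_data (t : nat) :=
  {r : respair t & (P2 * P2 * {ffun other_residue r -> nat})%type}.

(* The map lambda |-> (r_A, r_B; lambda^(r_A), lambda^(r_B); (m_i)_i). For a
   residue i other than r_A and r_B, lambda^(i) has at most one nonzero part,
   so that [part _ 0] is its single, possibly zero, part. *)
Definition to_quotient_data (t : nat) (lam : two_class_partition t) :
    quotient_data t :=
  let r := distinguished lam in
  let q := quotient t (t + 2) (sval lam) in
  existT _ r
    (exist _ (q (resA r)) (nparts_quotientA lam) : P2,
     exist _ (q (resB r)) (nparts_quotientB lam) : P2,
     [ffun i : other_residue r => part (q (sval i)) 0]).

(* Main.v *)
(** Everything rests on one fact: [beta n] and [unbeta] are mutually inverse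
    between partitions with at most [n] parts and [n]-element sets of naturals.
    Splitting the [N]-element beta set of [lam] into residue classes modulo [t]
    and dividing by [t] therefore loses nothing once the sizes of the classes
    are known, which gives the bijection. Since the sum of a beta set is the
    weight plus ['C(n, 2)], summing [b = (b %/ t) * t + b %% t] over the beta
    sets of [lam] and of its core, which have classes of the same sizes, gives
    the weight formula. *)
Require Import Defs.
From mathcomp Require Import all_boot.

Set Implicit Arguments.
Unset Strict Implicit.
Unset Printing Implicit Defensive.

(** * Decreasing lists of naturals *)

Lemma geq_trans : transitive geq.
Proof. by move=> y x z xy yz; exact: leq_trans yz xy. Qed.

Lemma geq_total : total geq.
Proof. by move=> x y; exact: leq_total. Qed.

Lemma gtn_trans : transitive gtn.
Proof. by move=> y x z xy yz; exact: ltn_trans yz xy. Qed.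

Lemma geq_anti : antisymmetric geq.
Proof. by move=> x y /=; rewrite andbC => /anti_leq. Qed.

Lemma sorted_gtn_geq s : sorted gtn s = uniq s && sorted geq s.
Proof.
rewrite (sorted_pairwise gtn_trans) (sorted_pairwise geq_trans).
rewrite uniq_pairwise -pairwise_relI; apply: eq_pairwise => x y /=.
by rewrite ltn_neqAle eq_sym.
Qed.

(** The zeros of a decreasing list all lie at its end, so dropping them only replaces stored zeros
    by the default value of [nth]. *)
Lemma nth_filter_pos s j :
  sorted geq s -> nth 0 [seq x <- s | 0 < x] j = nth 0 s j.
Proof.
elim: s j => [|[|x] s IHs] j //= s_dec; last first.
  by case: j => //= j; apply: IHs; exact: path_sorted s_dec.
have s0 : all (pred1 0) s.
  move: s_dec; rewrite (path_sortedE geq_trans) => /andP[/allP le0 _].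
  by apply/allP => y /le0; rewrite /= leqn0.
have -> : [seq x <- s | 0 < x] = [::].
  apply/eqP; rewrite -[_ == _]negbK -has_filter -all_predC.
  by apply: sub_all s0 => y /eqP->.
rewrite nth_nil; case: j => //= j; have [lt_j|le_j] := ltnP j (size s).
  by have /eqP-> := allP s0 _ (mem_nth 0 lt_j).
by rewrite nth_default.
Qed.

(** * Partitions as eventually zero sequences *)

Lemma part_nparts (lam : intpart) j : (0 < part lam j) = (j < nparts lam).
Proof.
rewrite /part /nparts; have [lt_j|le_j] := ltnP j; last by rewrite nth_default.
have /andP[_ nz] := valP lam; rewrite lt0n.
by apply: contraNneq nz => <-; exact: mem_nth.
Qed.

Lemma part_leq (lam : intpart) i j : i <= j -> part lam j <= part lam i.
Proof.
move=> le_ij; have [lt_j|] := ltnP j (nparts lam); last first.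
  by move=> le_j; rewrite [part lam j]nth_default.
have /andP[lam_dec _] := valP lam.
by apply: (sorted_leq_nth geq_trans leqnn 0 lam_dec) => //;
   exact: leq_ltn_trans lt_j.
Qed.

Lemma eq_part (lam mu : intpart) : part lam =1 part mu -> lam = mu.
Proof.
move=> eq_lm; have eq_n : nparts lam = nparts mu.
  have lt_n j : (j < nparts lam) = (j < nparts mu).
    by rewrite -(part_nparts lam) -(part_nparts mu) eq_lm.
  have := lt_n (nparts mu); have := lt_n (nparts lam); rewrite !ltnn.
  by case: ltngtP.
by apply/val_inj/(@eq_from_nth _ 0) => [|j _]; [exact: eq_n | exact: eq_lm].
Qed.

(** * Beta sets and their inverse *)

Lemma size_beta n lam : size (beta n lam) = n.
Proof. by rewrite size_map size_iota. Qed.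

Lemma nth_beta n lam j :
  j < n -> nth 0 (beta n lam) j = part lam j + (n - j.+1).
Proof. by move=> lt_j; rewrite (nth_map 0) ?size_iota // nth_iota. Qed.

Lemma beta_sorted n lam : sorted gtn (beta n lam).
Proof.
apply/(sortedP 0) => j; rewrite size_beta => lt_j.
rewrite !nth_beta // 1?ltnW //= -addnS leq_add ?part_leq //.
by rewrite -subSn // subSS.
Qed.

Lemma beta_uniq n lam : uniq (beta n lam).
Proof. by have := beta_sorted n lam; rewrite sorted_gtn_geq => /andP[]. Qed.

(** Sorting after removing duplicates sees only the underlying set, so a beta set may be listed in
    any order. *)
Lemma eq_mem_unbeta s1 s2 : s1 =i s2 -> unbeta s1 = unbeta s2.
Proof.
move=> eq_s; apply/val_inj; rewrite /= /unbeta_seq.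
suff -> : sort geq (undup s1) = sort geq (undup s2) by [].
apply/(perm_sortP geq_total geq_trans geq_anti).
by apply: uniq_perm; rewrite ?undup_uniq // => x; rewrite !mem_undup.
Qed.

Lemma part_unbeta s j :
  sorted gtn s -> part (unbeta s) j = nth 0 s j - (size s - j.+1).
Proof.
move=> s_dec; have := s_dec; rewrite sorted_gtn_geq => /andP[s_uniq s_geq].
rewrite /part /parts /= /unbeta_seq undup_id // (sorted_sort geq_trans) //.
rewrite nth_filter_pos.
  have [lt_j|le_j] := ltnP j (size s).
    by rewrite (nth_map 0) ?size_iota // nth_iota.
  by rewrite !nth_default ?size_map ?size_iota.
apply/(sortedP 0) => i; rewrite size_map size_iota => lt_i.
rewrite !(nth_map 0) ?size_iota ?(ltnW lt_i) // !nth_iota ?(ltnW lt_i) //.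
have /(sortedP 0)/(_ i lt_i)/= lt_s := s_dec.
rewrite !add0n -[size s - i.+1]subnSK // -[leqLHS]subSS.
exact: leq_sub2r.
Qed.

Lemma unbeta_beta n lam : nparts lam <= n -> unbeta (beta n lam) = lam.
Proof.
move=> le_n; apply: eq_part => j; rewrite part_unbeta ?beta_sorted // size_beta.
have [lt_j|le_j] := ltnP j n; first by rewrite nth_beta // addnK.
(* Past position [n] both sides are 0, by default on the left and by the bound on [nparts lam] on
   the right. *)
rewrite nth_default ?size_beta // sub0n [part lam j]nth_default //.
exact: leq_trans le_j.
Qed.

(** The [size s - j.+1] entries after position [j] are distinct naturals below the entry there. This
    makes the truncated subtraction in [unbeta] exact. *)
Lemma sorted_gtn_nth s j :
  sorted gtn s -> j < size s -> size s - j.+1 <= nth 0 s j.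
Proof.
elim: s j => [|x s IHs] [|j] //= s_dec; last first.
  by rewrite ltnS subSS => /IHs; apply; exact: path_sorted s_dec.
case: s IHs s_dec => [|y s] //= IHs /andP[lt_yx s_dec] _.
by have := IHs 0 s_dec isT; rewrite /= !subSS !subn0 => /leq_ltn_trans->.
Qed.

Lemma beta_unbeta s : uniq s -> perm_eq (beta (size s) (unbeta s)) s.
Proof.
move=> s_uniq; pose b := sort geq s.
have bs : perm_eq b s by rewrite perm_sort.
have b_dec : sorted gtn b.
  by rewrite sorted_gtn_geq sort_uniq s_uniq (sort_sorted geq_total).
rewrite -(eq_mem_unbeta (perm_mem bs)) -(perm_size bs).
suff -> : beta (size b) (unbeta b) = b by [].
apply: (@eq_from_nth _ 0) => [|j]; rewrite size_beta // => lt_j.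
by rewrite nth_beta // part_unbeta // subnK // sorted_gtn_nth.
Qed.

Lemma weightE n lam : nparts lam <= n -> weight lam = \sum_(j < n) part lam j.
Proof.
move=> le_n; rewrite /weight sumnE (big_nth 0) -(big_mkord xpredT (part lam)).
rewrite (big_cat_nat (leq0n (nparts lam)) le_n) /= -[LHS]addn0; congr (_ + _).
rewrite big_nat_cond big1 // => j /andP[/andP[le_j _] _].
by rewrite /part nth_default.
Qed.

Lemma sumn_beta n lam :
  nparts lam <= n -> sumn (beta n lam) = weight lam + 'C(n, 2).
Proof.
move=> le_n; rewrite sumnE big_map -{1}[n]subn0 big_mkord.
rewrite big_split /= -weightE //.
(* Read backwards, the shifts are 0, 1, ..., n - 1, whose sum is ['C(n, 2)]. *)
congr (_ + _); rewrite -bin2_sum big_mkord (reindex_inj rev_ord_inj) /=.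
by apply: eq_bigr => i _; rewrite subnSK // subKn // ltnW.
Qed.

Lemma sumn_unbeta s : uniq s -> sumn s = weight (unbeta s) + 'C(size s, 2).
Proof.
move=> s_uniq; rewrite -(perm_sumn (beta_unbeta s_uniq)).
by rewrite sumn_beta ?nparts_unbeta.
Qed.

(** * Splitting a set into residue classes and reassembling it *)

(** In abacus terms, [c i] lists the bead positions on runner [i]. The core is the case where every
    [c i] is an initial segment of the naturals. *)
Definition interleave (t : nat) (c : nat -> seq nat) : seq nat :=
  [seq i + k * t | i <- iota 0 t, k <- c i].

(** Euclidean division by [t] is unique, so distinct pairs of a runner and a position give distinct
    numbers. *)
Lemma mem_interleave t c i k :
  i < t -> (i + k * t \in interleave t c) = (k \in c i).
Proof.
move=> lt_i; apply/allpairsPdep/idP => [[j [l []]]|ck]; last first.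
  by exists i, k; rewrite mem_iota.
rewrite mem_iota /= add0n => lt_j cl eq_b.
have t_gt0 := leq_ltn_trans (leq0n i) lt_i.
have := congr1 (modn^~ t) eq_b; have := congr1 (divn^~ t) eq_b.
rewrite /= ![_ + _ * t]addnC !divnMDl // !modnMDl !divn_small // !modn_small //.
by rewrite !addn0 => -> ->.
Qed.

Lemma interleave_uniq t c :
  (forall i, i < t -> uniq (c i)) -> uniq (interleave t c).
Proof.
move=> c_uniq; apply: allpairs_uniq_dep; first exact: iota_uniq.
  by move=> i; rewrite mem_iota => /c_uniq.
move=> _ _ /allpairsPdep[i [k [+ _ ->]]] /allpairsPdep[j [l [+ _ ->]]] /=.
rewrite !mem_iota /= !add0n => lt_i lt_j eq_b.
have t_gt0 := leq_ltn_trans (leq0n i) lt_i.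
have := congr1 (modn^~ t) eq_b; have := congr1 (divn^~ t) eq_b.
rewrite /= ![_ + _ * t]addnC !divnMDl // !modnMDl !divn_small // !modn_small //.
by rewrite !addn0 => -> ->.
Qed.

Lemma size_interleave t c : size (interleave t c) = \sum_(i < t) size (c i).
Proof. by rewrite size_allpairs_dep sumnE big_map -{1}[t]subn0 big_mkord. Qed.

Lemma sumn_interleave t c :
  sumn (interleave t c) = \sum_(i < t) (size (c i) * i + sumn (c i) * t).
Proof.
rewrite sumnE big_allpairs_dep /= -{1}[t]subn0 big_mkord.
apply: eq_bigr => i _; rewrite big_split /=.
by rewrite big_const_seq count_predT iter_addn_0 mulnC sumnE big_distrl.
Qed.

Definition class_quotients (t N : nat) (lam : intpart) (i : nat) : seq nat :=
  [seq b %/ t | b <- residue_class t N lam i].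

Lemma mem_class_quotients t N lam i k :
  i < t -> (k \in class_quotients t N lam i) = (i + k * t \in beta N lam).
Proof.
move=> lt_i; have t_gt0 := leq_ltn_trans (leq0n i) lt_i.
apply/mapP/idP => [[b + ->]|b_k].
  by rewrite mem_filter => /andP[/eqP<- b_b]; rewrite addnC -divn_eq.
exists (i + k * t); last by rewrite addnC divnMDl // divn_small // addn0.
by rewrite mem_filter b_k addnC modnMDl modn_small // eqxx.
Qed.

Lemma class_quotients_uniq t N lam i : uniq (class_quotients t N lam i).
Proof.
rewrite map_inj_in_uniq ?filter_uniq ?beta_uniq // => b c.
rewrite !mem_filter => /andP[/eqP b_i _] /andP[/eqP c_i _] eq_q.
by rewrite (divn_eq b t) (divn_eq c t) eq_q b_i c_i.
Qed.

Lemma size_class_quotients t N lam i :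
  size (class_quotients t N lam i) = size (residue_class t N lam i).
Proof. exact: size_map. Qed.

Lemma interleave_class_quotients t N lam :
  0 < t -> perm_eq (interleave t (class_quotients t N lam)) (beta N lam).
Proof.
move=> t_gt0; apply: uniq_perm; rewrite ?beta_uniq //.
  by apply: interleave_uniq => i _; exact: class_quotients_uniq.
move=> b; rewrite (divn_eq b t) addnC mem_interleave ?ltn_mod //.
by rewrite mem_class_quotients ?ltn_mod.
Qed.

(** * The weight formula for arbitrary class sizes *)

Lemma core_weight_formula t N lam : 0 < t -> nparts lam <= N ->
  weight lam =
    weight (core t N lam) + t * \sum_(i < t) weight (quotient t N lam i).
Proof.
move=> t_gt0 le_N; have bI := interleave_class_quotients N lam t_gt0.
pose c i := iota 0 (size (residue_class t N lam i)).
have size_c : size (interleave t c) = N.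
  rewrite -[RHS](size_beta N lam) -(perm_size bI) !size_interleave.
  by apply: eq_bigr => i _; rewrite size_iota size_map.
have c_uniq : uniq (interleave t c).
  by apply: interleave_uniq => i _; exact: iota_uniq.
have := sumn_unbeta c_uniq; have := sumn_beta le_N.
rewrite -(perm_sumn bI) !sumn_interleave size_c => sum_lam sum_core.
(* Both beta sets have [N] elements, so adding ['C(N, 2)] turns the weights of [lam] and of its core
   into sums of beta sets. *)
apply/(@addIn 'C(N, 2)); rewrite -sum_lam addnAC.
rewrite -[core _ _ _]/(unbeta (interleave t c)) -sum_core.
rewrite mulnC big_distrl -big_split /=; apply: eq_bigr => i _.
(* On one class the residues contribute equally to both sides. The quotients of [lam] exceed those
   of the core, which sum to the binomial, by the weight of the quotient partition. *)
rewrite sumn_unbeta ?class_quotients_uniq // !size_map size_iota -addnA -mulnDl.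
congr (_ + _ * t); rewrite addnC; congr (_ + _).
by rewrite sumnE -bin2_sum /index_iota subn0.
Qed.

(** * Reconstruction from class sizes and quotient *)

(** By [beta_unbeta], the size of a class and its quotient partition recover the class, and the
    classes together recover the beta set. *)
Lemma eq_quotient t N lam mu : 0 < t -> nparts lam <= N -> nparts mu <= N ->
    (forall i, i < t ->
       size (residue_class t N lam i) = size (residue_class t N mu i)) ->
    (forall i, i < t -> quotient t N lam i = quotient t N mu i) ->
  lam = mu.
Proof.
move=> t_gt0 le_lam le_mu eq_size eq_quo.
rewrite -(unbeta_beta le_lam) -(unbeta_beta le_mu); apply: eq_mem_unbeta => b.
have lt_b : b %% t < t by rewrite ltn_mod.
rewrite (divn_eq b t) addnC -!mem_class_quotients //.
rewrite -(perm_mem (beta_unbeta (class_quotients_uniq t N lam _))).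
rewrite -(perm_mem (beta_unbeta (class_quotients_uniq t N mu _))).
by rewrite !size_map eq_size // -!/(quotient _ _ _ _) eq_quo.
Qed.

Section FromQuotient.

Variables (t N : nat) (n : nat -> nat) (q : nat -> intpart).
Hypothesis q_n : forall i, i < t -> nparts (q i) <= n i.
Hypothesis sum_n : \sum_(i < t) n i = N.

Definition from_quotient : intpart :=
  unbeta (interleave t (fun i => beta (n i) (q i))).

Lemma size_from_quotient : size (interleave t (fun i => beta (n i) (q i))) = N.
Proof.
by rewrite size_interleave -sum_n; apply: eq_bigr => i _; rewrite size_beta.
Qed.

Lemma nparts_from_quotient : nparts from_quotient <= N.
Proof. by rewrite -size_from_quotient nparts_unbeta. Qed.

Lemma class_quotients_from_quotient i : i < t ->
  perm_eq (class_quotients t N from_quotient i) (beta (n i) (q i)).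
Proof.
move=> lt_i; apply: uniq_perm; rewrite ?class_quotients_uniq ?beta_uniq // => k.
rewrite mem_class_quotients // -size_from_quotient.
rewrite (perm_mem (beta_unbeta _)) ?mem_interleave //.
by apply: interleave_uniq => j _; exact: beta_uniq.
Qed.

Lemma size_residue_class_from_quotient i :
  i < t -> size (residue_class t N from_quotient i) = n i.
Proof.
move=> lt_i; rewrite -size_class_quotients.
by rewrite (perm_size (class_quotients_from_quotient lt_i)) size_beta.
Qed.

Lemma quotient_from_quotient i :
  i < t -> quotient t N from_quotient i = q i.
Proof.
move=> lt_i; rewrite -(unbeta_beta (q_n lt_i)); apply: eq_mem_unbeta.
exact/perm_mem/class_quotients_from_quotient.
Qed.

End FromQuotient.

(** * Partitions with at most one part *)

Lemma unbeta_part0 lam : nparts lam <= 1 -> unbeta [:: part lam 0] = lam.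
Proof. by move=> le1; rewrite -{2}(unbeta_beta le1) /beta /= addn0. Qed.

Lemma part_unbeta1 x : part (unbeta [:: x]) 0 = x.
Proof. by rewrite part_unbeta //= subn0. Qed.

Lemma weight_part0 lam : nparts lam <= 1 -> weight lam = part lam 0.
Proof. by move=> le1; rewrite (weightE le1) big_ord1. Qed.

(** * The two-class profile and the inverse map *)

Section TwoClass.

Variable t : nat.
Implicit Types (r : respair t) (d : quotient_data t).
Implicit Type lam : two_class_partition t.

Definition class_size r (i : nat) : nat :=
  if (i == resA r) || (i == resB r) then 2 else 1.

Lemma resA_ltB r : resA r < resB r. Proof. exact: valP r. Qed.

Lemma resB_neqA r : resB r != resA r.
Proof. by rewrite -val_eqE neq_ltn resA_ltB orbT. Qed.

Lemma sum_class_size r : \sum_(i < t) class_size r i = t + 2.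
Proof.
rewrite (bigD1 (resA r)) // (bigD1 (resB r)) ?resB_neqA //=.
rewrite /class_size !eqxx orbT /= (eq_bigr (fun=> 1)) => [|i /andP[iA iB]].
  rewrite -[in RHS](card_ord t) -sum1_card [in RHS](bigD1 (resA r)) //=.
  by rewrite [in RHS](bigD1 (resB r)) ?resB_neqA //= [RHS]addnC !addnA.
by rewrite val_eqE (negPf iA) val_eqE (negPf iB).
Qed.

Lemma two_class_atP N (mu : intpart) r :
  reflect (forall i, i < t -> size (residue_class t N mu i) = class_size r i)
          (two_class_at N mu r).
Proof.
apply: (iffP forallP) => [H i lt_i | H i]; last exact/eqP/H.
exact/eqP/(H (Ordinal lt_i)).
Qed.

(** The class sizes determine the unordered pair, and the condition r_A < r_B then fixes its
    order. *)
Lemma two_class_at_inj N (mu : intpart) r r' :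
  two_class_at N mu r -> two_class_at N mu r' -> r = r'.
Proof.
move=> /two_class_atP Hr /two_class_atP Hr'.
have eq_r (i : 'I_t) :
    (i == resA r) || (i == resB r) = (i == resA r') || (i == resB r').
  have := Hr i (ltn_ord i); rewrite Hr' // /class_size !val_eqE.
  by do 2!case: ifP.
have := eq_r (resB r); have := eq_r (resA r); rewrite !eqxx orbT /=.
have := resA_ltB r; have := resA_ltB r'.
case: r r' {Hr Hr' eq_r} => [[A B] ltAB] [[A' B'] ltAB'].
(* Of the four ways to match the entries, two make those of the first pair equal and one swaps the
   pairs. Each of these contradicts the strict order. *)
rewrite /resA /resB /= => lt lt' /esym/orP[]/eqP eqA /esym/orP[]/eqP eqB;
  apply: val_inj; rewrite /= eqA eqB //.
- by move: lt'; rewrite eqA eqB ltnn.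
- by move: lt'; rewrite eqA eqB ltnNge ltnW.
- by move: lt'; rewrite eqA eqB ltnn.
Qed.

(* The sum has the single term [m i] when [i] is an undistinguished residue. *)
Definition data_quotient d (i : nat) : intpart :=
  let: existT r (alpha, gamma, m) := d in
  if i == resA r then sval alpha else
  if i == resB r then sval gamma else
  unbeta [:: \sum_(j : other_residue r | i == sval j) m j].

Lemma nparts_data_quotient d i :
  nparts (data_quotient d i) <= class_size (projT1 d) i.
Proof.
case: d => r [[alpha gamma] m] /=; rewrite /class_size.
case: ifP => _; first exact: valP alpha.
case: ifP => _; first exact: valP gamma.
exact: nparts_unbeta.
Qed.

Definition data_partition d : intpart :=
  from_quotient t (class_size (projT1 d)) (data_quotient d).

Lemma data_partition_two_class_at d :
  two_class_at (t + 2) (data_partition d) (projT1 d).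
Proof.
apply/two_class_atP => i.
exact/size_residue_class_from_quotient/sum_class_size.
Qed.

Lemma quotient_data_partition d i :
  i < t -> quotient t (t + 2) (data_partition d) i = data_quotient d i.
Proof.
apply: quotient_from_quotient; last exact: sum_class_size.
by move=> j _; exact: nparts_data_quotient.
Qed.

Lemma data_partitionP d :
  (nparts (data_partition d) <= t + 2)
  && two_class t (t + 2) (data_partition d).
Proof.
rewrite nparts_from_quotient ?sum_class_size //=.
by apply/existsP; exists (projT1 d); exact: data_partition_two_class_at.
Qed.

Definition of_quotient_data d : two_class_partition t :=
  exist _ (data_partition d) (data_partitionP d).

Lemma nparts_other_quotient lam (i : other_residue (distinguished lam)) :
  nparts (quotient t (t + 2) (sval lam) (sval i)) <= 1.
Proof.
have /two_class_atP/(_ _ (ltn_ord (sval i))) := distinguishedP lam.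
rewrite /class_size !val_eqE; case/andP: (valP i) => /negPf-> /negPf-> size1.
by rewrite (leq_trans (nparts_unbeta _)) // size_map size1.
Qed.

Lemma data_quotient_to_quotient_data lam i :
  i < t ->
  data_quotient (to_quotient_data lam) i = quotient t (t + 2) (sval lam) i.
Proof.
move=> lt_i /=; case: eqP => [-> //|/eqP iA]; case: eqP => [-> //|/eqP iB].
have oi : (Ordinal lt_i != resA (distinguished lam))
          && (Ordinal lt_i != resB (distinguished lam)) by apply/andP.
pose j : other_residue (distinguished lam) := exist _ (Ordinal lt_i) oi.
rewrite (big_pred1 j) => [|k]; last by rewrite eq_sym.
by rewrite ffunE unbeta_part0 // (nparts_other_quotient j).
Qed.

Lemma to_quotient_dataK : cancel (@to_quotient_data t) of_quotient_data.
Proof.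
move=> lam; apply: val_inj => /=; case/andP: (valP lam) => le_lam _.
(* The existence of a residue in ['I_t] already forces [t] to be positive. *)
have t_gt0 : 0 < t by case: (resA (distinguished lam)) => i; apply: leq_trans.
apply: (@eq_quotient t (t + 2)) => //.
- by case/andP: (data_partitionP (to_quotient_data lam)).
- move=> i lt_i; have /two_class_atP-> // := distinguishedP lam.
  by have /two_class_atP-> := data_partition_two_class_at (to_quotient_data lam).
- move=> i lt_i.
  by rewrite quotient_data_partition ?data_quotient_to_quotient_data.
Qed.

Lemma of_quotient_dataK : cancel of_quotient_data (@to_quotient_data t).
Proof.
move=> d; rewrite /to_quotient_data.
(* The bound proofs mention the chosen pair. Generalizing them lets this pair be replaced by that of
   [d] throughout the dependent tuple. *)
move: (nparts_quotientA _) (nparts_quotientB _).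
have := two_class_at_inj (distinguishedP (of_quotient_data d))
          (data_partition_two_class_at d).
move: (distinguished _) => r -> {r}; move: (quotient_data_partition d).
case: d => r [[alpha gamma] m] /= qE leA leB.
apply: (congr1 (existT _ r)); congr (_, _, _).
- by apply: val_inj; rewrite /= qE //= eqxx.
- by apply: val_inj; rewrite /= qE //= val_eqE (negPf (resB_neqA r)) eqxx.
apply/ffunP => j; rewrite ffunE qE // !val_eqE.
case/andP: (valP j) => /negPf-> /negPf->; rewrite part_unbeta1.
by rewrite (big_pred1 j) // => k; rewrite eq_sym.
Qed.

(** Off the distinguished residues a quotient has at most one part, so its weight is that part. *)
Lemma sum_weight_quotient lam :
  let r := distinguished lam in
  let q := quotient t (t + 2) (sval lam) in
  \sum_(i < t) weight (q i) = weight (q (resA r)) + weight (q (resB r)) +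
    \sum_(i : other_residue r) part (q (sval i)) 0.
Proof.
move=> r q; rewrite (bigD1 (resA r)) // (bigD1 (resB r)) ?resB_neqA //= addnA.
congr (_ + _); rewrite (big_sub [pred i | (i != resA r) && (i != resB r)]) /=.
by apply: eq_bigr => i _; rewrite weight_part0 ?nparts_other_quotient.
Qed.

End TwoClass.

Theorem proposition3p6 (t : nat) (ht : 2 <= t) :
  [/\ bijective (@to_quotient_data t),
      forall lam mu : two_class_partition t,
        projT1 (to_quotient_data lam) = projT1 (to_quotient_data mu) ->
        core t (t + 2) (sval lam) = core t (t + 2) (sval mu)
    & forall lam : two_class_partition t,
        let: existT r (alpha, gamma, m) := to_quotient_data lam in
        weight (sval lam) =
          weight (core t (t + 2) (sval lam)) +
          t * (weight (sval alpha) + weight (sval gamma) +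
               \sum_(i : other_residue r) m i)].
Proof.
split=> [|lam mu /= eq_r|lam].
- exists (@of_quotient_data t); first exact: to_quotient_dataK.
  exact: of_quotient_dataK.
(* The core is built from the class sizes alone, and the profile prescribes these in terms of the
   pair. *)
- apply: eq_mem_unbeta => b; congr (b \in flatten _).
  apply/eq_in_map => i; rewrite mem_iota => lt_i.
  have /two_class_atP-> // := distinguishedP lam.
  by have /two_class_atP-> // := distinguishedP mu; rewrite eq_r.
- case/andP: (valP lam) => le_lam _ /=.
  rewrite (core_weight_formula (ltnW ht) le_lam) sum_weight_quotient.
  by under [in RHS]eq_bigr do rewrite ffunE.
Qed.
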